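(* Let $(M,\varphi,\xi,\eta,g,\varepsilon)$ be an $n$-dimensional $(\varepsilon)$-para Sasakian manifold with $n>2$. Suppose that $\xi=\mathrm{grad}(f)$ for a smooth function $f$ on $M$ and that $\lambda,\mu$ are real constants with $$\mathrm{Hess}(f)+S+\lambda g+\mu\,\eta\otimes\eta=0$$ (that is, this equation defines a gradient $\eta$-Ricci soliton on $(M,g)$). If the Ricci operator $Q$ is Codazzi, i.e. $(\nabla_XQ)Y=(\nabla_YQ)X$ for all vector fields $X,Y$ on $M$, then $$(\lambda,\mu)\in\{(\varepsilon n,-1),\ (\varepsilon(n-2),1)\}.$$ In particular, the soliton is expanding ($\lambda>0$) if $M$ is spacelike ($\varepsilon=1$) and shrinking ($\lambda<0$) if $M$ is timelike ($\varepsilon=-1$).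
   Context: An $(\varepsilon)$-almost paracontact metric manifold is an $n$-dimensional manifold $M$ with a $(1,1)$-tensor field $\varphi$, a vector field $\xi$, a $1$-form $\eta$, a pseudo-Riemannian metric $g$ and $\varepsilon\in\{1,-1\}$ satisfying $\varphi^2=I-\eta\otimes\xi$ (i.e. $\varphi^2X=X-\eta(X)\xi$), $\eta(\xi)=1$, $\varphi\xi=0$, $\eta\circ\varphi=0$ and $g(\varphi X,\varphi Y)=g(X,Y)-\varepsilon\eta(X)\eta(Y)$. It is called spacelike if $\varepsilon=1$ and timelike if $\varepsilon=-1$. It is $(\varepsilon)$-para Sasakian if $(\nabla_X\varphi)Y=-g(\varphi X,\varphi Y)\xi-\varepsilon\eta(Y)\varphi^2X$ for all vector fields $X,Y$, where $\nabla$ is the Levi-Civita connection of $g$. Curvature: $R(X,Y)Z=\nabla_X\nabla_YZ-\nabla_Y\nabla_XZ-\nabla_{[X,Y]}Z$; $S(Y,Z)$ is the Ricci tensor, the trace of $X\mapsto R(X,Y)Z$; the Ricci operator $Q$ is defined by $g(QX,Y)=S(X,Y)$. $\mathrm{Hess}(f)(X,Y)=g(\nabla_X\,\mathrm{grad}(f),Y)$. *)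

(* Defs.v *)
From HB Require Import structures.
From mathcomp Require Import all_boot all_order all_algebra.
From mathcomp Require Import all_classical all_reals all_analysis.
From mathcomp Require Import ring.
Set Implicit Arguments.
Unset Strict Implicit.
Unset Printing Implicit Defensive.
Import Order.TTheory GRing.Theory Num.Theory.
Import numFieldNormedType.Exports.
Local Open Scope classical_set_scope.
Local Open Scope ring_scope.

Section smooth_on.
Context {R : realType} {V : normedModType R}.

(* Meaningful for [U] open.  [k] is the number of times [f] can be
   differentiated on [U]; all the iterated directional derivatives of [f] being
   differentiable amounts to all its iterated differentials being so. *)
Fixpoint times_differentiable_on (W : normedModType R) (k : nat) (U : set V)
    (f : V -> W) : Prop :=
  if k is k'.+1 then
    (forall x, U x -> differentiable f x) /\
    (forall v, times_differentiable_on k' U (fun x => 'D_v f x))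
  else True.

Definition smooth_on (W : normedModType R) (U : set V) (f : V -> W) : Prop :=
  forall k, times_differentiable_on k U f.

Section closure.
Variable U : set V.
Hypothesis openU : open U.

Lemma times_differentiable_on_ext (W : normedModType R) k (f g : V -> W) :
  (forall x, U x -> f x = g x) ->
  times_differentiable_on k U f -> times_differentiable_on k U g.
Proof.
elim: k f g => // k IH f g fg [df Df].
have nfg x : U x -> \near x, f x = g x.
  by move=> Ux; apply: filterS (open_nbhs_nbhs (conj openU Ux)).
split=> [x Ux|v].
- have dfx := df _ Ux; have gf : \forall y \near x, g y = f y.
    by apply: filterS (nfg _ Ux) => y ->.
  have gx : g x = f x by exact: nbhs_singleton gf.
  have /diff_locallyP [cd dE] := dfx.
  have E : g \o shift x = cst (g x) + 'd f x +o_ 0 id.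
    rewrite gx; apply/eqaddoP => e e0.
    have /eqaddoP/(_ e e0) fe := dE.
    have gfx : \forall h \near (0 : V), g (h + x) = f (h + x).
      by move: gf; rewrite (near_shift 0) subr0.
    apply: filterS2 gfx fe => h gfh.
    by rewrite /= !fctE /= gfh.
  apply/diff_locallyP.
  by have -> : 'd g x = 'd f x :> (V -> W) by apply: diff_unique.
- apply: IH (Df v) => x Ux.
  exact: near_eq_derive (nfg _ Ux).
Unshelve. all: by end_near. Qed.

Lemma times_differentiable_on_lower (W : normedModType R) k (f : V -> W) :
  times_differentiable_on k.+1 U f -> times_differentiable_on k U f.
Proof.
elim: k f => // k IH f [df Df]; split=> // v.
exact/IH/Df.
Qed.

Lemma times_differentiable_on_cst (W : normedModType R) k (a : W) :
  times_differentiable_on k U (cst a).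
Proof.
elim: k a => // k IH a; split=> [x _|v]; first exact: differentiable_cst.
rewrite (_ : (fun x => _) = cst 0); last first.
  by apply/funext => x; rewrite derive_cst.
exact: IH.
Qed.

Lemma times_differentiable_on_add (W : normedModType R) k (f g : V -> W) :
  times_differentiable_on k U f -> times_differentiable_on k U g ->
  times_differentiable_on k U (f + g).
Proof.
elim: k f g => // k IH f g [df Df] [dg Dg]; split=> [x Ux|v].
  exact: differentiableD (df _ Ux) (dg _ Ux).
apply: times_differentiable_on_ext (IH _ _ (Df v) (Dg v)) => x Ux.
by rewrite deriveD //; apply: diff_derivable; [exact: df|exact: dg].
Qed.

Lemma times_differentiable_on_mul k (f g : V -> R) :
  times_differentiable_on k U f -> times_differentiable_on k U g ->
  times_differentiable_on k U (f * g).
Proof.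
elim: k f g => // k IH f g hf hg.
have [[df Df] [dg Dg]] := (hf, hg); split=> [x Ux|v].
  exact: differentiableM (df _ Ux) (dg _ Ux).
have hf' := times_differentiable_on_lower hf.
have hg' := times_differentiable_on_lower hg.
apply: times_differentiable_on_ext (times_differentiable_on_add
  (IH _ _ hf' (Dg v)) (IH _ _ hg' (Df v))) => x Ux.
by rewrite deriveM //; apply: diff_derivable; [exact: df|exact: dg].
Qed.

End closure.
End smooth_on.

Record chart (R : realType) (n : nat) (M : topologicalType) := Chart {
  chart_dom : set M;
  chart_map : M -> 'rV[R]_n;
  chart_inv : 'rV[R]_n -> M;
  chart_dom_open : open chart_dom;
  chart_img_open : open (chart_map @` chart_dom);
  chart_mapK : forall p, chart_dom p -> chart_inv (chart_map p) = p;
  chart_map_continuous : {in chart_dom, continuous chart_map};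
  chart_inv_continuous : {in chart_map @` chart_dom, continuous chart_inv} }.

Arguments chart_dom_open {R n M} c.
Arguments chart_img_open {R n M} c.

Definition chart_img (R : realType) (n : nat) (M : topologicalType)
  (c : chart R n M) : set 'rV[R]_n := chart_map c @` chart_dom c.

(* The atlas is not required to be maximal: an atlas and the maximal atlas
   containing it have the same smooth functions. *)
Record manifold (R : realType) (n : nat) := Manifold {
  carrier :> topologicalType;
  manifold_hausdorff : hausdorff_space carrier;
  manifold_second_countable : @second_countable carrier;
  manifold_nonempty : [set: carrier] !=set0;
  atlas : set (chart R n carrier);
  atlas_cover : forall p : carrier, exists2 c, atlas c & chart_dom c p;
  atlas_compatible : forall c c', atlas c -> atlas c' ->
    smooth_on (chart_map c @` (chart_dom c `&` chart_dom c'))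
              (chart_map c' \o chart_inv c) }.

Section smooth_functions.
Context {R : realType} {n : nat}.
Variable M : manifold R n.

Definition smooth (f : M -> R) : Prop :=
  forall c, atlas c -> smooth_on (chart_img c) (f \o chart_inv c).

Definition smooth_pred : pred (M -> R) := fun f => `[< smooth f >].

Lemma smooth_subring_closed : subring_closed smooth_pred.
Proof.
have cstS (a : R) : smooth (cst a).
  by move=> c _ k; exact: times_differentiable_on_cst.
have mulS f g : smooth f -> smooth g -> smooth (f * g).
  move=> sf sg c hc k.
  exact: (times_differentiable_on_mul (chart_img_open c) (sf c hc k) (sg c hc k)).
split.
- by apply/asboolP; exact: cstS.
- move=> f g /asboolP sf /asboolP sg; apply/asboolP.
  rewrite -mulN1r => c hc k.
  exact: (times_differentiable_on_add (chart_img_open c) (sf c hc k)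
    (mulS (cst (-1)) g (cstS _) sg c hc k)).
- by move=> f g /asboolP sf /asboolP sg; apply/asboolP; exact: mulS.
Qed.

Lemma smooth_scaler_closed : scaler_closed smooth_pred.
Proof.
move=> a f /asboolP sf; apply/asboolP => c hc k.
exact: (times_differentiable_on_mul (chart_img_open c)
  (times_differentiable_on_cst _ _ a) (sf c hc k)).
Qed.

HB.instance Definition _ :=
  GRing.isSubringClosed.Build (M -> R) smooth_pred smooth_subring_closed.
HB.instance Definition _ :=
  GRing.isScaleClosed.Build R (M -> R) smooth_pred smooth_scaler_closed.

Record Cinfty := MkCinfty {
  smooth_val :> M -> R;
  smooth_valP : smooth_val \in smooth_pred }.

HB.instance Definition _ := [isSub for smooth_val].
HB.instance Definition _ := [Choice of Cinfty by <:].
HB.instance Definition _ :=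
  GRing.SubChoice_isSubComPzRing.Build _ _ Cinfty smooth_subring_closed.
HB.instance Definition _ := [SubZmodule_isSubLmodule of Cinfty by <:].

Lemma Cinfty_ext (f g : Cinfty) : (forall p, f p = g p) -> f = g.
Proof. by move=> fg; apply/val_inj/funext. Qed.

Lemma Cinfty0E p : (0 : Cinfty) p = 0. Proof. by []. Qed.
Lemma Cinfty1E p : (1 : Cinfty) p = 1. Proof. by []. Qed.
Lemma CinftyDE (f g : Cinfty) p : (f + g) p = f p + g p. Proof. by []. Qed.
Lemma CinftyNE (f : Cinfty) p : (- f) p = - f p. Proof. by []. Qed.
Lemma CinftyME (f g : Cinfty) p : (f * g) p = f p * g p. Proof. by []. Qed.
Lemma CinftyZE (a : R) (f : Cinfty) p : (a *: f) p = a * f p. Proof. by []. Qed.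
Definition CinftyE :=
  (Cinfty0E, Cinfty1E, CinftyDE, CinftyNE, CinftyME, CinftyZE).

End smooth_functions.

Section vector_fields.
Context {R : realType} {n : nat}.
Variable M : manifold R n.

Definition derivation (X : Cinfty M -> Cinfty M) : Prop :=
  (forall (a : R) f h, X (a *: f + h) = a *: X f + X h) /\
  (forall f h, X (f * h) = X f * h + f * X h).

Definition derivation_pred : pred (Cinfty M -> (Cinfty M)^o) :=
  fun X => `[< derivation X >].

Lemma derivation_submod_closed : submod_closed derivation_pred.
Proof.
split=> [|f X Y /asboolP[XL XM] /asboolP[YL YM]].
  by apply/asboolP; split=> [a f h|f h]; apply: Cinfty_ext => p;
    rewrite !CinftyE /=; ring.
apply/asboolP; split=> [a h k|h k]; apply: Cinfty_ext => p.
  rewrite -[LHS]/((f * X (a *: h + k) + Y (a *: h + k) : Cinfty M) p).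
  rewrite -[RHS]/((a *: (f * X h + Y h) + (f * X k + Y k) : Cinfty M) p).
  by rewrite XL YL !CinftyE; ring.
rewrite -[LHS]/((f * X (h * k) + Y (h * k) : Cinfty M) p).
rewrite -[RHS]/(((f * X h + Y h) * k + h * (f * X k + Y k) : Cinfty M) p).
by rewrite XM YM !CinftyE; ring.
Qed.

HB.instance Definition _ :=
  GRing.isSubmodClosed.Build (Cinfty M) (Cinfty M -> (Cinfty M)^o)
    derivation_pred derivation_submod_closed.

(* Vector fields are the derivations of the R-algebra of smooth functions;
   they form a module over that algebra. *)
Record vector_field := VectorField {
  vector_field_val : Cinfty M -> (Cinfty M)^o;
  vector_field_valP : vector_field_val \in derivation_pred }.

HB.instance Definition _ := [isSub for vector_field_val].
HB.instance Definition _ := [Choice of vector_field by <:].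
HB.instance Definition _ := [SubChoice_isSubLmodule of vector_field by <:].

Definition vector_field_app (X : vector_field) (f : Cinfty M) : Cinfty M :=
  vector_field_val X f.

Coercion vector_field_app : vector_field >-> Funclass.

Lemma vector_field_derivation (X : vector_field) : derivation X.
Proof. by have /asboolP := vector_field_valP X. Qed.

Lemma bracket_subproof (X Y : vector_field) :
  (fun f => X (Y f) - Y (X f)) \in derivation_pred.
Proof.
have [XL XM] := vector_field_derivation X.
have [YL YM] := vector_field_derivation Y.
have XD u v : X (u + v) = X u + X v by rewrite -[u]scale1r XL !scale1r.
have YD u v : Y (u + v) = Y u + Y v by rewrite -[u]scale1r YL !scale1r.
apply/asboolP; split=> [a f h|f h]; apply: Cinfty_ext => p.
  rewrite -[LHS]/((X (Y (a *: f + h)) - Y (X (a *: f + h)) : Cinfty M) p).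
  rewrite -[RHS]/((a *: (X (Y f) - Y (X f)) + (X (Y h) - Y (X h)) : Cinfty M) p).
  by rewrite YL !XL YL !CinftyE; ring.
rewrite -[LHS]/((X (Y (f * h)) - Y (X (f * h)) : Cinfty M) p).
rewrite -[RHS]/(((X (Y f) - Y (X f)) * h + f * (X (Y h) - Y (X h)) : Cinfty M) p).
by rewrite YM XM XD YD !XM !YM !CinftyE; ring.
Qed.

Definition bracket (X Y : vector_field) : vector_field :=
  VectorField (bracket_subproof X Y).

End vector_fields.

Section tangent.
Context {R : realType} {n : nat} {M : manifold R n}.
Implicit Types (p : M) (X Y Z : vector_field M) (A : vector_field M -> vector_field M).

Definition tangent_vector p (v : Cinfty M -> R) : Prop :=
  (forall (a : R) f h, v (a *: f + h) = a * v f + v h) /\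
  (forall f h, v (f * h) = v f * h p + f p * v h).

(* The value at [p] of the vector field [X] is [fun f => X f p]. *)
Definition tangent_basis p (E : 'I_n -> vector_field M) : Prop :=
  (forall v, tangent_vector p v ->
     exists c : 'I_n -> R, forall f, v f = \sum_j c j * E j f p) /\
  (forall c : 'I_n -> R,
     (forall f, \sum_j c j * E j f p = 0) -> forall j, c j = 0).

(* [t] is the trace of the endomorphism of the tangent space at [p] induced by
   the (1,1)-tensor field [A], computed in a basis; it does not depend on the
   choice of the basis nor of its extension to vector fields. *)
Definition trace_at p A (t : R) : Prop :=
  exists (E : 'I_n -> vector_field M) (a : 'M[R]_n),
    [/\ tangent_basis p E,
        forall i f, A (E i) f p = \sum_j a i j * E j f p
      & t = \tr a].

End tangent.

Section pseudo_riemannian.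
Context {R : realType} {n : nat} {M : manifold R n}.
Local Notation VF := (vector_field M).
Implicit Types (X Y Z : VF) (g S : VF -> VF -> Cinfty M)
  (nabla : VF -> VF -> VF).

(* Tensor fields are multilinear maps over the algebra of smooth functions. *)
Record pseudo_riemannian_metric g : Prop := {
  metric_linear : forall Z (a : Cinfty M) X Y,
    g Z (a *: X + Y) = a * g Z X + g Z Y;
  metric_sym : forall X Y, g X Y = g Y X;
  metric_nondegenerate : forall (p : M) X,
    (forall Y, g X Y p = 0) -> forall f : Cinfty M, X f p = 0 }.

Record levi_civita g nabla : Prop := {
  connection_linear : forall (a : Cinfty M) X Y Z,
    nabla (a *: X + Y) Z = a *: nabla X Z + nabla Y Z;
  connection_additive : forall X Y Z, nabla X (Y + Z) = nabla X Y + nabla X Z;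
  connection_leibniz : forall (a : Cinfty M) X Y,
    nabla X (a *: Y) = X a *: Y + a *: nabla X Y;
  torsion_free : forall X Y, nabla X Y - nabla Y X = bracket X Y;
  metric_compatible : forall X Y Z,
    X (g Y Z) = g (nabla X Y) Z + g Y (nabla X Z) }.

Definition curvature nabla X Y Z : VF :=
  nabla X (nabla Y Z) - nabla Y (nabla X Z) - nabla (bracket X Y) Z.

Definition ricci_tensor nabla S : Prop :=
  forall (p : M) Y Z, trace_at p (fun X => curvature nabla X Y Z) (S Y Z p).

Definition ricci_operator g S (Q : VF -> VF) : Prop :=
  forall X Y, g (Q X) Y = S X Y.

Definition gradient g (f : Cinfty M) (G : VF) : Prop :=
  forall X, g G X = X f.

(* The Hessian of a function whose gradient is [G]. *)
Definition hessian g nabla (G : VF) X Y : Cinfty M := g (nabla X G) Y.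

(* [cov_deriv nabla A X Y] is $(\nabla_X A) Y$ for a (1,1)-tensor field [A]. *)
Definition cov_deriv nabla (A : VF -> VF) X Y : VF :=
  nabla X (A Y) - A (nabla X Y).

Definition codazzi nabla (A : VF -> VF) : Prop :=
  forall X Y, cov_deriv nabla A X Y = cov_deriv nabla A Y X.

Record almost_paracontact_metric (phi : {linear VF -> VF}) (xi : VF)
    (eta : {linear VF -> (Cinfty M)^o}) g (eps : int) : Prop := {
  apm_metric : pseudo_riemannian_metric g;
  apm_eps : eps = 1 \/ eps = -1;
  apm_phi2 : forall X, phi (phi X) = X - (eta X : Cinfty M) *: xi;
  apm_eta_xi : eta xi = 1;
  apm_phi_xi : phi xi = 0;
  apm_eta_phi : forall X, eta (phi X) = 0;
  apm_compatible : forall X Y,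
    g (phi X) (phi Y) = g X Y - eps%:~R * (eta X * eta Y) }.

Definition para_sasakian (phi : {linear VF -> VF}) (xi : VF)
    (eta : {linear VF -> (Cinfty M)^o}) g (eps : int) nabla : Prop :=
  forall X Y, cov_deriv nabla phi X Y =
    - (g (phi X) (phi Y) *: xi) - (eps%:~R * eta Y : Cinfty M) *: phi (phi X).

End pseudo_riemannian.

(* Main.v *)
(* The para Sasakian identity at [Y = xi] gives [nabla_X xi = eps phi X], hence
   [R(X, xi) xi = eta(X) xi - X] and [S(xi, xi) = 1 - n].  The soliton equation
   at [(xi, xi)] then reads [eps lambda + mu = n - 1]; over all of [M] it reads
   [Q X = - (eps phi X + lambda X + eps mu eta(X) xi)].  For this [Q] the Codazzi
   equation on the pair [(xi, Y)] is [phi^2 Y = mu phi Y].  Since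
   [phi^3 = phi], this forces [(1 - mu^2) phi = 0], and [phi = 0] would make
   every tangent space the line spanned by [xi]; so [mu^2 = 1]. *)
Require Import Defs.
From mathcomp Require Import all_boot all_order all_algebra.
From mathcomp Require Import all_classical all_reals all_analysis.
From mathcomp Require Import ring lra.
Set Implicit Arguments.
Unset Strict Implicit.
Unset Printing Implicit Defensive.
Import Order.TTheory GRing.Theory Num.Theory.
Import numFieldNormedType.Exports.
Local Open Scope ring_scope.

(** * Vector fields as derivations, traces and tangent bases at a point *)

Section VectorFieldTheory.
Context {R : realType} {n : nat} {M : manifold R n}.
Implicit Types (X Y Z : vector_field M) (p : M) (a h : Cinfty M).

Lemma vector_field_ext X Y : (forall h p, X h p = Y h p) -> X = Y.
Proof.
by move=> XY; apply/val_inj/funext => h; apply: Cinfty_ext => p; exact: XY.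
Qed.

Lemma vector_fieldDE X Y h p : (X + Y) h p = X h p + Y h p.
Proof. by []. Qed.
Lemma vector_fieldNE X h p : (- X) h p = - X h p. Proof. by []. Qed.
Lemma vector_field0E h p : (0 : vector_field M) h p = 0. Proof. by []. Qed.
Lemma vector_fieldZE a X h p : (a *: X) h p = a p * X h p. Proof. by []. Qed.
Definition vector_fieldE :=
  (vector_fieldDE, vector_fieldNE, vector_field0E, vector_fieldZE).

Lemma vector_field_1 X : X 1 = 0.
Proof.
have [_ XM] := vector_field_derivation X.
have := XM 1 1; rewrite !mul1r mulr1 => /eqP.
by rewrite -subr_eq0 opprD addNKr oppr_eq0 => /eqP.
Qed.

Lemma vector_fieldD X a h : X (a + h) = X a + X h.
Proof.
have [XL _] := vector_field_derivation X.
by rewrite -[a]scale1r XL !scale1r.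
Qed.

Lemma vector_field0 X : X 0 = 0.
Proof.
by apply: (addrI (X 0)); rewrite -vector_fieldD !addr0.
Qed.

Lemma vector_fieldZ X (c : R) h : X (c *: h) = c *: X h.
Proof.
have [XL _] := vector_field_derivation X.
by have := XL c h 0; rewrite vector_field0 !addr0.
Qed.

Lemma vector_fieldM X a h : X (a * h) = X a * h + a * X h.
Proof. by have [_ ->] := vector_field_derivation X. Qed.

Lemma vector_field_cst X (c : R) : X (c *: (1 : Cinfty M)) = 0.
Proof. by rewrite vector_fieldZ vector_field_1 scaler0. Qed.

(** Turns a real scalar into a constant function, so that laws linear over the algebra of smooth
    functions apply to it. *)
Lemma Cinfty_scaleE (c : R) h : c *: h = (c *: (1 : Cinfty M)) * h.
Proof. by apply: Cinfty_ext => p; rewrite !CinftyE mulr1. Qed.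

Lemma Cinfty_int (z : int) : z%:~R = (z%:~R : R) *: (1 : Cinfty M).
Proof. by rewrite scaler_int. Qed.

Lemma Cinfty_intE (z : int) p : (z%:~R : Cinfty M) p = z%:~R.
Proof. by rewrite Cinfty_int CinftyZE mulr1. Qed.

Lemma Cinfty_natE (m : nat) p : (m%:R : Cinfty M) p = m%:R.
Proof. exact: (Cinfty_intE m). Qed.

Lemma tangent_vector_at X p : tangent_vector p (fun h => X h p).
Proof.
have [XL XM] := vector_field_derivation X.
by split=> [c h k|h k]; [rewrite XL|rewrite XM].
Qed.

Lemma tangent_basis_free p E (c d : 'I_n -> R) :
  tangent_basis p E ->
  (forall h : Cinfty M, \sum_j c j * E j h p = \sum_j d j * E j h p) ->
  forall j, c j = d j.
Proof.
case=> _ free cd j; apply/eqP; rewrite -subr_eq0; apply/eqP.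
apply: (free (fun j => c j - d j)) => h.
under eq_bigr do rewrite mulrBl.
by rewrite sumrB cd subrr.
Qed.

(** At [p], [A] is the rank-one map [b du] tensor [Z] minus the identity; the first part has as
    trace its covector evaluated on [Z], the second contributes [n]. Giving the covector as a
    differential lets the coordinates of [Z], which hold when tested on any function, be tested on
    [u] itself. *)
Lemma trace_at_rank1_sub_id p (A : vector_field M -> vector_field M) Z (b : R)
    (u : Cinfty M) t :
  (forall X h, A X h p = b * X u p * Z h p - X h p) ->
  trace_at p A t -> t = b * Z u p - n%:R.
Proof.
move=> AE [E [a [basisE aE ->]]].
have [c cE] := basisE.1 _ (tangent_vector_at Z p).
have aijE i j : a i j = b * E i u p * c j - (i == j)%:R.
  move: j; apply: (tangent_basis_free
    (d := fun j => b * E i u p * c j - (i == j)%:R) basisE) => h.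
  rewrite -aE AE cE mulr_sumr.
  under [RHS]eq_bigr do rewrite mulrBl.
  rewrite sumrB; congr (_ - _); first by apply: eq_bigr => j _; rewrite mulrA.
  rewrite (bigD1 i) //= eqxx mul1r big1 ?addr0 // => j ji.
  by rewrite eq_sym (negbTE ji) mul0r.
rewrite /mxtrace; under eq_bigr do rewrite aijE eqxx.
rewrite sumrB sumr_const card_ord cE mulr_sumr; congr (_ - _).
by apply: eq_bigr => i _; rewrite -mulrA [_ * c i]mulrC.
Qed.

(** Two vectors on one line are linearly dependent, whereas [1 < n] provides two distinct basis
    vectors. *)
Lemma tangent_basis_not_line p E Z (w : vector_field M -> Cinfty M) :
  (1 < n)%N -> tangent_basis p E -> ~ (forall X, X = w X *: Z).
Proof.
move=> n1 [_ free] line.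
have [i0 [i1 i10]] : exists i0 i1 : 'I_n, i1 != i0.
  by exists (Ordinal (ltnW n1)), (Ordinal n1).
have sum2 (x y : R) (h : Cinfty M) :
    \sum_j (if j == i0 then x else if j == i1 then y else 0) * E j h p
      = x * E i0 h p + y * E i1 h p.
  rewrite (bigD1 i0) //= (bigD1 i1) //= !eqxx (negbTE i10) big1 ?addr0 //.
  by move=> j /andP[/negbTE-> /negbTE->]; rewrite mul0r.
have lineE X (h : Cinfty M) : X h p = w X p * Z h p.
  by rewrite [in LHS](line X).
(* The combination [w (E i1) E i0 - w (E i0) E i1] vanishes at [p]; freeness kills its second
   coefficient. Then [E i0] itself vanishes at [p], which contradicts freeness. *)
have w0 : w (E i0) p = 0.
  have /free/(_ i1) : forall h : Cinfty M, \sum_j (if j == i0 then w (E i1) p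
      else if j == i1 then - w (E i0) p else 0) * E j h p = 0.
    by move=> h; rewrite sum2 (lineE (E i0)) (lineE (E i1)); ring.
  by rewrite (negbTE i10) eqxx => /eqP; rewrite oppr_eq0 => /eqP.
have /free/(_ i0) : forall h : Cinfty M, \sum_j (if j == i0 then 1
    else if j == i1 then 0 else 0) * E j h p = 0.
  by move=> h; rewrite sum2 (lineE (E i0)) w0; ring.
by rewrite eqxx => /eqP; rewrite oner_eq0.
Qed.

End VectorFieldTheory.

(** * Covariant derivatives, curvature and the Codazzi equation on a para Sasakian manifold *)

Section ParaSasakian.
Context {R : realType} {n : nat} {M : manifold R n}.
Local Notation VF := (vector_field M).
Context {phi : {linear VF -> VF}} {xi : VF} {eta : {linear VF -> (Cinfty M)^o}}
  {g : VF -> VF -> Cinfty M} {eps : int} {nabla : VF -> VF -> VF}.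
Hypothesis paracontact : almost_paracontact_metric phi xi eta g eps.
Hypothesis nabla_LC : levi_civita g nabla.
Hypothesis sasakian : para_sasakian phi xi eta g eps nabla.
Implicit Types (X Y Z : VF) (a : Cinfty M).

Lemma eps_sqr (A : pzRingType) : eps%:~R * eps%:~R = 1 :> A.
Proof. by case: (apm_eps paracontact) => ->; rewrite ?mulN1r ?mul1r ?opprK. Qed.

Lemma vector_field_eps X : X eps%:~R = 0.
Proof.
by rewrite Cinfty_int vector_field_cst.
Qed.

Lemma metric_linearl a X Y Z : g (a *: X + Y) Z = a * g X Z + g Y Z.
Proof.
have mg := apm_metric paracontact.
by rewrite !(Defs.metric_sym mg _ Z) (metric_linear mg).
Qed.

Lemma metric0l Z : g 0 Z = 0.
Proof.
apply: (addrI (g 0 Z)).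
by have := metric_linearl 1 0 0 Z; rewrite scaler0 !addr0 mul1r => <-.
Qed.

Lemma metricDl X Y Z : g (X + Y) Z = g X Z + g Y Z.
Proof. by rewrite -[X]scale1r metric_linearl scale1r mul1r. Qed.

Lemma metricZl a X Z : g (a *: X) Z = a * g X Z.
Proof. by rewrite -[a *: X]addr0 metric_linearl metric0l addr0. Qed.

Lemma metric_inj X Y : (forall Z, g X Z = g Y Z) -> X = Y.
Proof.
move=> XY; apply: vector_field_ext => h p; apply/eqP; rewrite -subr_eq0.
apply/eqP; rewrite -[LHS]/((X - Y) h p).
apply: (metric_nondegenerate (apm_metric paracontact)) => Z.
by rewrite -scaleN1r addrC metric_linearl XY mulN1r addNr.
Qed.

(** Compatibility of [g] with [phi] at [Y = xi], where [phi xi = 0] kills the left-hand side. *)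
Lemma metric_xi X : g X xi = eps%:~R * eta X.
Proof.
have := apm_compatible paracontact X xi.
rewrite (apm_phi_xi paracontact) (apm_eta_xi paracontact) mulr1.
rewrite (Defs.metric_sym (apm_metric paracontact)) metric0l => /esym/eqP.
by rewrite subr_eq0 => /eqP.
Qed.

Lemma eta_metric X : eta X = eps%:~R * g X xi.
Proof. by rewrite metric_xi mulrA eps_sqr mul1r. Qed.

(** Differentiate the constant function [g xi xi = eps] along [X]. *)
Lemma metric_nabla_xi X : g (nabla X xi) xi = 0.
Proof.
have := metric_compatible nabla_LC X xi xi.
rewrite metric_xi (apm_eta_xi paracontact) mulr1 vector_field_eps.
rewrite (Defs.metric_sym (apm_metric paracontact) xi) => h.
apply: Cinfty_ext => p; have := congr1 (fun u : Cinfty M => u p) h.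
by rewrite !CinftyE; lra.
Qed.

Lemma eta_nabla_xi X : eta (nabla X xi) = 0.
Proof. by rewrite eta_metric metric_nabla_xi mulr0. Qed.

Lemma nabla0 X : nabla X 0 = 0.
Proof.
by apply: (addrI (nabla X 0)); rewrite -(connection_additive nabla_LC) !addr0.
Qed.

(** The para Sasakian identity at [Y = xi] only gives [phi (nabla X xi) = eps phi (phi X)]. Applying
    [phi] once more recovers the vectors, since [nabla X xi] and [phi X] lie in the kernel of [eta],
    where [phi] squares to the identity. *)
Lemma nabla_xi X : nabla X xi = eps%:~R *: phi X.
Proof.
have := sasakian X xi; rewrite /cov_deriv (apm_phi_xi paracontact).
rewrite (Defs.metric_sym (apm_metric paracontact)) metric0l scale0r oppr0.
rewrite (apm_eta_xi paracontact) mulr1 !sub0r.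
rewrite nabla0 sub0r => /oppr_inj/(congr1 phi); rewrite linearZ /=.
rewrite !(apm_phi2 paracontact) eta_nabla_xi.
by rewrite scale0r subr0 (apm_eta_phi paracontact) scale0r subr0.
Qed.

Lemma nabla_xi_xi : nabla xi xi = 0.
Proof. by rewrite nabla_xi (apm_phi_xi paracontact) scaler0. Qed.

Lemma nabla_epsZ X Y : nabla X (eps%:~R *: Y) = eps%:~R *: nabla X Y.
Proof.
by rewrite (connection_leibniz nabla_LC) vector_field_eps scale0r add0r.
Qed.

(** Both terms on the right of the para Sasakian identity contain [phi X], which vanishes at
    [X = xi]. *)
Lemma nabla_xi_phi Y : nabla xi (phi Y) = phi (nabla xi Y).
Proof.
apply/eqP; rewrite -subr_eq0; apply/eqP.
rewrite -[LHS]/(cov_deriv nabla phi xi Y).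
rewrite sasakian (apm_phi_xi paracontact) metric0l linear0.
by rewrite scale0r scaler0 !oppr0 addr0.
Qed.

(** [eta] is [eps g(., xi)], and [xi] is parallel along itself. *)
Lemma nabla_xi_eta Y : xi (eta Y) = eta (nabla xi Y).
Proof.
rewrite !eta_metric vector_fieldM vector_field_eps mul0r add0r.
rewrite (metric_compatible nabla_LC) nabla_xi_xi.
by rewrite (Defs.metric_sym (apm_metric paracontact) Y 0) metric0l addr0.
Qed.

Lemma phiZ a X : phi (a *: X) = a *: phi X.
Proof. exact: linearZ. Qed.

Lemma phi_neq0 p E : (1 < n)%N -> @tangent_basis R n M p E ->
  ~ (forall X, phi X = 0).
Proof.
move=> n1 basisE phi0.
apply: (tangent_basis_not_line (Z := xi) (w := eta) n1 basisE) => X.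
apply/eqP; rewrite -subr_eq0; apply/eqP.
by rewrite -[LHS](apm_phi2 paracontact) phi0.
Qed.

Lemma phi3 X : phi (phi (phi X)) = phi X.
Proof.
by rewrite (apm_phi2 paracontact) (apm_eta_phi paracontact) scale0r subr0.
Qed.

(** Write the bracket as [nabla X xi - nabla xi X]. As [phi] commutes with [nabla xi], the terms in
    [nabla xi X] cancel and [- phi (phi X)] remains. *)
Lemma curvature_xi_xi X :
  curvature nabla X xi xi = (eta X : Cinfty M) *: xi - X.
Proof.
rewrite /curvature nabla_xi_xi !nabla_xi -(torsion_free nabla_LC) nabla_epsZ.
rewrite nabla_xi_phi nabla0 sub0r linearB /= nabla_xi phiZ.
rewrite scalerBr scalerA eps_sqr scale1r (apm_phi2 paracontact).
by rewrite opprB addrA addNr sub0r opprB.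
Qed.

Lemma ricci_xi_xi (S : VF -> VF -> Cinfty M) :
  (exists h : Cinfty M, forall X, X h = g X xi) ->
  ricci_tensor nabla S -> S xi xi = 1 - n%:R.
Proof.
case=> h hE ricS; apply: Cinfty_ext => p.
have := ricS p xi xi.
(* The potential [h] makes [eta] the differential [eps dh], hence the covector required by the trace
   formula. *)
move/(@trace_at_rank1_sub_id _ _ _ p _ xi ((eps%:~R : Cinfty M) p) h) => ->.
  rewrite hE -CinftyME -eta_metric (apm_eta_xi paracontact) !CinftyE.
  by rewrite Cinfty_natE.
by move=> X k; rewrite curvature_xi_xi !vector_fieldE hE eta_metric CinftyME.
Qed.

(** [phi], [xi] and [eta] are parallel along [xi], so the derivative of [Q] along [xi] vanishes. In
    the derivative along [Y] at [xi] the [l] terms cancel, leaving [phi (phi Y) - m phi Y]. *)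
Lemma codazzi_phi2 (Q : VF -> VF) (l m : R) :
  (forall X, Q X = - ((eps%:~R : Cinfty M) *: phi X + (l *: (1 : Cinfty M)) *: X
     + ((m *: (1 : Cinfty M)) * eps%:~R * eta X : Cinfty M) *: xi)) ->
  codazzi nabla Q ->
  forall Y, phi (phi Y) = (m *: (1 : Cinfty M)) *: phi Y.
Proof.
move=> QE codQ Y; have := codQ xi Y; rewrite /cov_deriv !QE.
have nablaN X Z : nabla X (- Z) = - nabla X Z.
  apply/eqP; rewrite -subr_eq0 opprK -(connection_additive nabla_LC).
  by rewrite addNr nabla0.
rewrite !nablaN !(connection_additive nabla_LC) !(connection_leibniz nabla_LC).
rewrite !vector_fieldM !vector_field_eps !vector_field_cst.
rewrite nabla_xi_phi nabla_xi_eta nabla_xi_xi eta_nabla_xi.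
rewrite (apm_phi_xi paracontact) nabla0 nabla_xi phiZ.
rewrite (apm_eta_xi paracontact) vector_field_1.
rewrite !(mul0r, mulr0, scale0r, scaler0, add0r, addr0, mulr1) subrr.
rewrite !scalerA -[_ * eps%:~R * eps%:~R]mulrA eps_sqr scale1r mulr1.
rewrite opprK addrC opprD addrA addrK => /esym/eqP.
by rewrite subr_eq0 => /eqP.
Qed.


End ParaSasakian.

Theorem mainTheorem4 (R : realType) (n : nat) (M : manifold R n)
    (phi : {linear vector_field M -> vector_field M})
    (xi : vector_field M)
    (eta : {linear vector_field M -> (Cinfty M)^o})
    (g : vector_field M -> vector_field M -> Cinfty M)
    (eps : int)
    (nabla : vector_field M -> vector_field M -> vector_field M)
    (S : vector_field M -> vector_field M -> Cinfty M)
    (Q : vector_field M -> vector_field M)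
    (f : Cinfty M) (grad_f : vector_field M) (lambda mu : R)
    (n_gt2 : (2 < n)%N)
    (paracontact : almost_paracontact_metric phi xi eta g eps)
    (nabla_LC : levi_civita g nabla)
    (sasakian : para_sasakian phi xi eta g eps nabla)
    (S_ricci : ricci_tensor nabla S)
    (Q_ricci : ricci_operator g S Q)
    (grad_fE : gradient g f grad_f)
    (xi_grad : xi = grad_f)
    (soliton : forall X Y : vector_field M,
       hessian g nabla grad_f X Y + S X Y + lambda *: g X Y
         + mu *: (eta X * eta Y : Cinfty M) = 0)
    (Q_codazzi : codazzi nabla Q) :
  ((lambda, mu) = (eps%:~R * n%:R, -1) \/
   (lambda, mu) = (eps%:~R * (n%:R - 2), 1)) /\
  (eps = 1 -> 0 < lambda) /\
  (eps = -1 -> lambda < 0).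
Proof.
subst grad_f.
have gsym := Defs.metric_sym (apm_metric paracontact).
have [p _] := manifold_nonempty M.
(* The trace defining the Ricci tensor carries a tangent basis at [p]; it later rules out
   [phi = 0]. *)
have [E [_ [basisE _ _]]] := S_ricci p xi xi.
have Sxi : S xi xi = 1 - n%:R.
  apply: (ricci_xi_xi paracontact nabla_LC sasakian _ S_ricci).
  by exists f => X; rewrite gsym grad_fE.
have QE X : Q X = - ((eps%:~R : Cinfty M) *: phi X
    + (lambda *: (1 : Cinfty M)) *: X
    + ((mu *: (1 : Cinfty M)) * eps%:~R * eta X : Cinfty M) *: xi).
  apply: (metric_inj paracontact) => Z; rewrite Q_ricci -[- _]scaleN1r.
  rewrite (metricZl paracontact) !(metricDl paracontact).
  rewrite !(metricZl paracontact) mulN1r (gsym xi) (metric_xi paracontact).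
  have := soliton X Z.
  rewrite /hessian (nabla_xi paracontact nabla_LC sasakian).
  rewrite (metricZl paracontact) (Cinfty_scaleE lambda) (Cinfty_scaleE mu).
  rewrite -!addrA addrCA => /eqP; rewrite addr_eq0 => /eqP ->.
  congr (- (_ + (_ + _))).
  (* The factor [eps] in the last term of [Q] cancels the one in [g xi Z = eps eta Z]. *)
  rewrite -!mulrA; congr (_ * _).
  rewrite [RHS]mulrCA [eps%:~R * (eps%:~R * _)]mulrA.
  by rewrite (eps_sqr paracontact) mul1r.
have phi2E := codazzi_phi2 paracontact nabla_LC sasakian QE Q_codazzi.
have mu2 : mu ^+ 2 = 1.
  apply/eqP/negPn/negP => mu2N1.
  apply: (phi_neq0 paracontact (ltnW n_gt2) basisE) => Y.
  apply: vector_field_ext => h q.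
  (* Evaluated at a function and a point, the identity lives in the field [R], where the nonzero
     factor [1 - mu ^+ 2] can be cancelled. *)
  have : phi Y h q = mu ^+ 2 * phi Y h q.
    rewrite -[in LHS](phi3 paracontact) phi2E vector_fieldZE phi2E.
    by rewrite vector_fieldZE CinftyZE Cinfty1E mulr1 mulrA.
  move/eqP; rewrite eq_sym -subr_eq0 -{2}[phi Y h q]mul1r -mulrBl mulf_eq0.
  by rewrite subr_eq0 (negbTE mu2N1) => /eqP.
have lambda_mu : eps%:~R * lambda + mu = n%:R - 1 :> R.
  have := congr1 (fun u : Cinfty M => u p) (soliton xi xi).
  rewrite /hessian (nabla_xi_xi paracontact nabla_LC sasakian).
  rewrite (metric0l paracontact) add0r Sxi (metric_xi paracontact).
  rewrite (apm_eta_xi paracontact) !mulr1 !CinftyE Cinfty_natE Cinfty_intE.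
  by lra.
have n2 : 2 < n%:R :> R by rewrite ltr_nat.
have lambdaE : lambda = eps%:~R * (n%:R - 1 - mu).
  by rewrite -lambda_mu addrK mulrA (eps_sqr paracontact) mul1r.
have /orP mu1 : (mu == 1) || (mu == -1) by rewrite -eqf_sqr expr1n mu2.
split; last first.
  (* In both cases [lambda] is [eps] times [n] or [n - 2], which are positive by [n2]. *)
  by split=> epsE; rewrite lambdaE epsE; case: mu1 => /eqP ->; lra.
case: mu1 => /eqP muE; [right|left]; rewrite lambdaE muE; congr (_ * _, _); lra.
Qed.
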